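(* Let $G$ be a compact Lie group with a left-invariant Riemannian metric, and let $H:T^*G\to\mathbb{R}$ be the Hamiltonian of the associated geodesic flow. Then $H$ is weakly integrable.
   Context: Let $\mathfrak g$ be the Lie algebra of $G$ and $L_g:h\mapsto gh$ the left translations. A left-invariant Riemannian metric on $G$ is determined by a symmetric positive definite operator $A:\mathfrak g\to\mathfrak g^*$; it is extended to all fibers by $A_g:T_gG\to T_g^*G$, $A_g\dot g=L_{g^{-1}}^*A\,(L_{g^{-1}})_*\dot g$. The geodesic flow is the flow of the Lagrangian $L(g,\dot g)=\frac12\langle A_g\dot g,\dot g\rangle$, and the corresponding Hamiltonian is $H(g,p)=\frac12\langle p,A_g^{-1}p\rangle$ on $T^*G$ with its canonical symplectic form $\omega$. $X_f$ denotes the Hamiltonian vector field of $f$ (so $df=\omega(X_f,\cdot)$) and $\{f,g\}=\omega(X_f,X_g)$. An integral of motion of $H$ is a function $F:T^*G\to\mathbb{R}$ with $\{H,F\}\equiv0$. $H$ is weakly integrable if there exist $n=\dim G$ integrals of motion of $H$ that are $C^2$ and whose differentials are linearly independent at each point of $T^*G$. *)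

(* Defs.v *)
From HB Require Import structures.
From mathcomp Require Import all_boot all_order all_algebra.
From mathcomp Require Import all_classical all_reals all_analysis.

Set Implicit Arguments.
Unset Strict Implicit.
Unset Printing Implicit Defensive.

Import Order.TTheory GRing.Theory Num.Theory.
Import numFieldNormedType.Exports.

Local Open Scope classical_set_scope.
Local Open Scope ring_scope.

(* Vectors and covectors of R^n are both row vectors. Linear maps act on
   vectors by v |-> v *m J (the convention of [jacobian]), hence the dual map
   acts on covectors by p |-> p *m J^T. *)
Definition pairing (R : realType) (n : nat) (p v : 'rV[R]_n) : R :=
  (p *m v^T) 0 0.

(* C^k on a set of interior points of the domain, the sets U below being open:
   f is C^k.+1 when it is differentiable with C^k partial derivatives. *)
Fixpoint Ck_on (R : realType) (m : nat) (W : normedModType R) (k : nat)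
    (U : set 'rV[R]_m) (f : 'rV[R]_m -> W) : Prop :=
  if k is k'.+1 then
    (forall x, U x -> differentiable f x) /\
    (forall i : 'I_m, Ck_on k' U (fun x => 'D_(delta_mx 0 i) f x))
  else forall x, U x -> {for x, continuous f}.

Definition smooth_on (R : realType) (m : nat) (W : normedModType R)
    (U : set 'rV[R]_m) (f : 'rV[R]_m -> W) : Prop :=
  forall k, Ck_on k U f.

(* A family of charts with values in R^n, without any axiom; [chart_inv c] is
   only meaningful on [chart_cod c]. The tangent space of M at x is R^n, a
   tangent vector being given by its coordinates in the distinguished chart
   [chart_at x]; covectors at x are expressed in the dual basis. *)
Record atlas (R : realType) (n : nat) (M : Type) := Atlas {
  chart : Type;
  chart_dom : chart -> set M;
  chart_map : chart -> M -> 'rV[R]_n;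
  chart_inv : chart -> 'rV[R]_n -> M;
  chart_at : M -> chart }.

Definition chart_cod (R : realType) (n : nat) (M : Type) (C : atlas R n M)
    (c : chart C) : set 'rV[R]_n :=
  chart_map c @` chart_dom c.

Definition transition (R : realType) (n : nat) (M : Type) (C : atlas R n M)
    (c d : chart C) : 'rV[R]_n -> 'rV[R]_n :=
  chart_map d \o chart_inv c.

Record smooth_manifold (R : realType) (n : nat) (M : topologicalType)
    (C : atlas R n M) : Prop := SmoothManifold {
  manifold_hausdorff : hausdorff_space M;
  manifold_second_countable : @second_countable M;
  chart_at_dom : forall x : M, chart_dom (chart_at C x) x;
  open_chart_dom : forall c : chart C, open (chart_dom c);
  open_chart_cod : forall c : chart C, open (chart_cod c);
  chart_mapK : forall (c : chart C) x,
    chart_dom c x -> chart_inv c (chart_map c x) = x;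
  chart_map_continuous : forall (c : chart C) x,
    chart_dom c x -> {for x, continuous (chart_map c)};
  chart_inv_continuous : forall (c : chart C) y,
    chart_cod c y -> {for y, continuous (chart_inv c)};
  transition_smooth : forall c d : chart C,
    smooth_on (chart_map c @` (chart_dom c `&` chart_dom d)) (transition c d) }.

Definition prod_atlas (R : realType) (m n : nat) (M N : Type)
    (C : atlas R m M) (D : atlas R n N) : atlas R (m + n) (M * N) :=
  @Atlas R (m + n) (M * N) (chart C * chart D)
    (fun c => chart_dom c.1 `*` chart_dom c.2)
    (fun c x => row_mx (chart_map c.1 x.1) (chart_map c.2 x.2))
    (fun c y => (chart_inv c.1 (lsubmx y), chart_inv c.2 (rsubmx y)))
    (fun x => (chart_at C x.1, chart_at D x.2)).

Definition smooth_map (R : realType) (m n : nat) (M N : topologicalType)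
    (C : atlas R m M) (D : atlas R n N) (f : M -> N) : Prop :=
  continuous f /\
  forall (c : chart C) (d : chart D),
    smooth_on (chart_map c @` (chart_dom c `&` f @^-1` chart_dom d))
              (chart_map d \o f \o chart_inv c).

(* The matrix of T_x M -> T_(f x) N. *)
Definition tangent_map (R : realType) (m n : nat) (M N : Type)
    (C : atlas R m M) (D : atlas R n N) (f : M -> N) (x : M) : 'M[R]_(m, n) :=
  jacobian (chart_map (chart_at D (f x)) \o f \o chart_inv (chart_at C x))
           (chart_map (chart_at C x) x).

Definition Ck_function (R : realType) (n : nat) (M : Type) (C : atlas R n M)
    (k : nat) (f : M -> R) : Prop :=
  forall c : chart C, Ck_on k (chart_cod c) (f \o chart_inv c : _ -> R^o).

(* The covector df(x). *)
Definition differential (R : realType) (n : nat) (M : Type) (C : atlas R n M)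
    (f : M -> R) (x : M) : 'rV[R]_n :=
  \row_i 'D_(delta_mx 0 i) (f \o chart_inv (chart_at C x) : _ -> R^o)
           (chart_map (chart_at C x) x).

(* A point (x, p) of T^*M; p is given in the chart [chart_at x]. This is not
   the type M * 'rV_n, whose product topology is in general not the topology
   of T^*M. *)
Record cotangent (R : realType) (n : nat) (M : Type) := Cotangent {
  foot : M;
  covector : 'rV[R]_n }.

(* The matrix converting the coordinates of tangent vectors at x from the
   chart c to the chart d. *)
Definition coord_change (R : realType) (n : nat) (M : Type) (C : atlas R n M)
    (c d : chart C) (x : M) : 'M[R]_n :=
  jacobian (transition c d) (chart_map c x).

(* The canonical charts (q, p) of T^*M: if v has coordinates v_c in the chart
   c and v_c *m J in the chart [chart_at x], then <p, v> = <p *m J^T, v_c>. *)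
Definition cotangent_atlas (R : realType) (n : nat) (M : Type)
    (C : atlas R n M) : atlas R (n + n) (cotangent R n M) :=
  @Atlas R (n + n) (cotangent R n M) (chart C)
    (fun c => [set z | chart_dom c (foot z)])
    (fun c z => row_mx (chart_map c (foot z))
       (covector z *m (coord_change c (chart_at C (foot z)) (foot z))^T))
    (fun c y => let x := chart_inv c (lsubmx y) in
       Cotangent x (rsubmx y *m (coord_change (chart_at C x) c x)^T))
    (fun z => chart_at C (foot z)).

(* The canonical symplectic form sum_i dq_i /\ dp_i (which is - d(p dq)). As
   tangent vectors of T^*M at z are expressed in the canonical chart
   [chart_at z], it has the same expression at all points z. *)
Definition symplectic_form (R : realType) (n : nat) (u v : 'rV[R]_(n + n)) : R :=
  pairing (rsubmx v) (lsubmx u) - pairing (rsubmx u) (lsubmx v).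

Definition hamiltonian_vf (R : realType) (n : nat) (M : Type) (C : atlas R n M)
    (f : cotangent R n M -> R) (z : cotangent R n M) : 'rV[R]_(n + n) :=
  let df := differential (cotangent_atlas C) f z in
  row_mx (rsubmx df) (- lsubmx df).

Lemma hamiltonian_vfP (R : realType) (n : nat) (M : Type) (C : atlas R n M)
    (f : cotangent R n M -> R) (z : cotangent R n M) (u : 'rV[R]_(n + n)) :
  (forall v, pairing (differential (cotangent_atlas C) f z) v =
             symplectic_form u v) <->
  u = hamiltonian_vf C f z.
Proof.
rewrite /hamiltonian_vf; set df := differential _ _ _.
have pE (a v : 'rV[R]_(n + n)) : pairing a v =
    pairing (lsubmx a) (lsubmx v) + pairing (rsubmx a) (rsubmx v).
  by rewrite /pairing -{1}[a]hsubmxK -{1}[v]hsubmxK tr_row_mx mul_row_col mxE.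
have pC (a b : 'rV[R]_n) : pairing a b = pairing b a.
  by rewrite /pairing !mxE; apply: eq_bigr => i _; rewrite !mxE mulrC.
have pN (a b : 'rV[R]_n) : pairing (- a) b = - pairing a b.
  by rewrite /pairing mulNmx mxE.
have wE (w v : 'rV[R]_(n + n)) :
    pairing (row_mx (- rsubmx w) (lsubmx w)) v = symplectic_form w v.
  by rewrite pE row_mxKl row_mxKr pN /symplectic_form [in RHS]addrC
             (pC (rsubmx v)).
have pD (a b : 'rV[R]_(n + n)) : (forall v, pairing a v = pairing b v) -> a = b.
  move=> ab; apply/rowP => i; have := ab (delta_mx 0 i).
  by rewrite /pairing !trmx_delta -!colE !mxE.
split=> [duE | ->] => [|v]; last first.
  by rewrite -wE row_mxKl row_mxKr opprK hsubmxK.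
have -> : df = row_mx (- rsubmx u) (lsubmx u).
  by apply: pD => v; rewrite duE wE.
by rewrite row_mxKl row_mxKr opprK hsubmxK.
Qed.

Definition poisson_bracket (R : realType) (n : nat) (M : Type)
    (C : atlas R n M) (f g : cotangent R n M -> R) (z : cotangent R n M) : R :=
  symplectic_form (hamiltonian_vf C f z) (hamiltonian_vf C g z).

Definition integral_of_motion (R : realType) (n : nat) (M : Type)
    (C : atlas R n M) (H F : cotangent R n M -> R) : Prop :=
  forall z, poisson_bracket C H F z = 0.

Definition weakly_integrable (R : realType) (n : nat) (M : Type)
    (C : atlas R n M) (H : cotangent R n M -> R) : Prop :=
  exists F : 'I_n -> cotangent R n M -> R,
    [/\ forall i, integral_of_motion C H (F i),
        forall i, Ck_function (cotangent_atlas C) 2 (F i) &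
        forall z, free [tuple differential (cotangent_atlas C) (F i) z | i < n]].

(* A group with a topology, without compatibility; see [lie_group]. *)
#[short(type="groupTopologicalType")]
HB.structure Definition GroupTopological := {G of Topological G & Group G}.

Record lie_group (R : realType) (n : nat) (G : groupTopologicalType)
    (C : atlas R n G) : Prop := LieGroup {
  lie_group_manifold : smooth_manifold C;
  lie_group_mul_smooth :
    smooth_map (prod_atlas C C) C (fun gh : G * G => (gh.1 * gh.2)%g);
  lie_group_inv_smooth : smooth_map C C (fun g : G => g^-1%g) }.

(* The operator g -> g^*, v |-> v *m A, in the chart [chart_at 1]. *)
Definition symmetric_posdef (R : realType) (n : nat) (A : 'M[R]_n) : Prop :=
  (forall u v, pairing (u *m A) v = pairing (v *m A) u) /\
  (forall v, v != 0 -> 0 < pairing (v *m A) v).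

(* A_g, again acting by v |-> v *m A_g. With J the matrix of the tangent map at
   g of the left translation by g^-1, which sends T_g G to T_1 G = g, the
   pullback of covectors is the product by J^T. *)
Definition left_invariant_metric (R : realType) (n : nat)
    (G : groupTopologicalType) (C : atlas R n G) (A : 'M[R]_n) (g : G) :
    'M[R]_n :=
  let J := tangent_map C C (fun h : G => (g^-1 * h)%g) g in
  J *m A *m J^T.

Definition geodesic_hamiltonian (R : realType) (n : nat)
    (G : groupTopologicalType) (C : atlas R n G) (A : 'M[R]_n)
    (z : cotangent R n G) : R :=
  2^-1 * pairing (covector z)
    (covector z *m invmx (left_invariant_metric C A (foot z))).

(* Main.v *)
Require Import Defs.
From mathcomp Require Import all_boot all_order all_algebra.
From mathcomp Require Import ring lra.
From mathcomp Require Import all_classical all_reals all_analysis.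

(** Let k_a and r_i be the left- and the right-invariant vector fields on G
    extending the standard basis of the Lie algebra. The integrals are the
    momenta F_i(x, p) = <p, r_i(x)> of the action of G on itself by left
    translations: their derivatives in p are the vectors r_i(x), which form a
    basis. In the left-invariant frame, H = 1/2 sum_(a, b) (A^-1)_(a, b) l_a l_b
    with l_a(x, p) = <p, k_a(x)>, and {l_a, F_i} = <p, D_(r_i) k_a - D_(k_a) r_i>
    vanishes because left and right translations commute: both terms are mixed
    second derivatives of (s, t) |-> s x t. *)

Set Implicit Arguments.
Unset Strict Implicit.
Unset Printing Implicit Defensive.

Import Order.TTheory GRing.Theory Num.Theory.
Import numFieldNormedType.Exports.

Local Open Scope classical_set_scope.
Local Open Scope ring_scope.

(** * Differential calculus *)

(** Tangent vectors and covectors at x are expressed in [chart_at x], an arbitrary choice of chart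
    that may jump from one point to the next, so the momenta and the Hamiltonian cannot be
    differentiated as they are written. Over one fixed chart [c] the coordinate changes of the
    covector and of the vector are dual to each other and cancel in the pairing. What is left is a
    function p.X(q) on an open set of R^(2n), where X is a partial derivative of the group
    multiplication read in charts. Regularity, brackets and independence are obtained there. Since X
    is already a first derivative of the multiplication, the brackets involve its second
    derivatives, whence the detour through their symmetry. *)

Section Differentiation.
Variable R : realType.

Lemma linear_rV_continuous (m : nat) (W : normedModType R)
  (f : {linear 'rV[R]_m -> W}) : continuous f.
Proof.
have -> : (f : _ -> _) = \sum_(i < m) (fun x : 'rV[R]_m => x 0 i *: f (delta_mx 0 i)).
  apply/funext => x; rewrite fct_sumE {1}[x]row_sum_delta linear_sum.
  by apply: eq_bigr => i _; rewrite linearZ.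
move=> x; apply: differentiable_continuous; apply: differentiable_sum => i.
apply: (@differentiableZl _ _ _ (fun y : 'rV[R]_m => y 0 i : R^o)).
exact: differentiable_coord.
Qed.

Lemma near_eq_differentiable (V W : normedModType R) (f g : V -> W) (x : V) :
  {near x, f =1 g} -> differentiable f x -> differentiable g x.
Proof.
(* The differential is selected by [get], so one continuous linear map with the right expansion
   suffices, and ['d f x] is one. The point [lim (nbhs x)] is [x], in the form that the definition
   of the differential gives it. *)
move=> fg df; apply/diffP; apply: (@getPex _ (fun dg : {linear V -> W} =>
  continuous dg /\ forall y, g y = g (lim (nbhs x)) + dg (y - lim (nbhs x))
     +o_(y \near x) (y - lim (nbhs x)))).
exists ('d f x); split; first exact: diff_continuous.
have fgx : f x = g x := nbhs_singleton fg.
suff gE : g = (fun y => g (lim (nbhs x)) + 'd f x (y - lim (nbhs x))) +o_ x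
    (fun y => y - lim (nbhs x)) by move=> y; rewrite [in LHS]gE.
have /eqaddoP fo : f = (fun y => f (lim (nbhs x)) + 'd f x (y - lim (nbhs x))) +o_ x
    (fun y => y - lim (nbhs x)).
  by apply/funext => y; exact: diffE.
apply/eqaddoP => e e0; near=> y.
have -> : (g - (fun y => g (lim (nbhs x)) + 'd f x (y - lim (nbhs x)))) y =
  (f - (fun y => f (lim (nbhs x)) + 'd f x (y - lim (nbhs x)))) y.
  by rewrite !fctE lim_id // fgx (near fg y).
by near: y; exact: fo.
Unshelve. all: by end_near. Qed.

Lemma derive_comp (U V W : normedModType R) (f : U -> V) (g : V -> W) (x v : U) :
  differentiable f x -> differentiable g (f x) ->
  'D_v (g \o f) x = 'D_('D_v f x) g (f x).
Proof.
move=> df dg; rewrite deriveE; last exact: differentiable_comp.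
by rewrite diff_comp // [RHS]deriveE // [in RHS]deriveE.
Qed.

Lemma row_jacobian (m n : nat) (f : 'rV[R]_m -> 'rV[R]_n) (x : 'rV[R]_m) i :
  differentiable f x -> row i (jacobian f x) = 'D_(delta_mx 0 i) f x.
Proof. by move=> df; rewrite (deriveEjacobian _ df) rowE. Qed.

Lemma jacobian_comp (m n p : nat) (f : 'rV[R]_m -> 'rV[R]_n)
    (g : 'rV[R]_n -> 'rV[R]_p) (x : 'rV[R]_m) :
  differentiable f x -> differentiable g (f x) ->
  jacobian (g \o f) x = jacobian f x *m jacobian g (f x).
Proof.
move=> df dg; apply/row_matrixP => i.
rewrite (row_jacobian _ (differentiable_comp df dg)) row_mul (row_jacobian _ df).
by rewrite -(deriveEjacobian _ dg) derive_comp.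
Qed.

Lemma near_eq_jacobian (m n : nat) (f g : 'rV[R]_m -> 'rV[R]_n) (x : 'rV[R]_m) :
  differentiable f x -> differentiable g x -> {near x, f =1 g} ->
  jacobian f x = jacobian g x.
Proof.
move=> df dg fg; apply/row_matrixP => i.
apply: etrans (row_jacobian i df) _; apply: etrans _ (esym (row_jacobian i dg)).
exact: near_eq_derive.
Qed.

Lemma derive_rV_sum (m : nat) (W : normedModType R) (f : 'rV[R]_m -> W)
    (x v : 'rV[R]_m) :
  differentiable f x ->
  'D_v f x = \sum_i v 0 i *: 'D_(delta_mx 0 i) f x.
Proof.
move=> df; rewrite deriveE // {1}[v]row_sum_delta linear_sum.
by apply: eq_bigr => i _; rewrite linearZ -deriveE.
Qed.

Lemma derive_linear (m : nat) (W : normedModType R) (f : {linear 'rV[R]_m -> W})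
    (x v : 'rV[R]_m) : 'D_v f x = f v.
Proof.
have cf := @linear_rV_continuous m W f.
by rewrite deriveE ?diff_lin //; exact: linear_differentiable.
Qed.

Lemma linear_rV_differentiable (m : nat) (W : normedModType R)
  (f : {linear 'rV[R]_m -> W}) x : differentiable f x.
Proof. exact/linear_differentiable/linear_rV_continuous. Qed.

Lemma derive_coord (V : normedModType R) (m n : nat) (f : V -> 'M[R]_(m, n)) (x v : V) i j :
  differentiable f x ->
  'D_v (fun y => f y i j : R^o) x = 'D_v f x i j.
Proof.
by move=> df; rewrite derive_mx ?mxE//; apply: diff_derivable.
Qed.

End Differentiation.

(** * Functions of class C^k *)

Section Ck.
Variables (R : realType) (m : nat).
Implicit Types (W : normedModType R) (U : set 'rV[R]_m).

Lemma Ck_on_sub W k U V (f : 'rV[R]_m -> W) :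
  U `<=` V -> Ck_on k V f -> Ck_on k U f.
Proof.
move=> UV; elim: k f => [|k IH] f /= ; first by move=> h x /UV; exact: h.
by case=> df h; split=> [x /UV|i]; [exact: df|exact: IH].
Qed.

(** On an open [U], equality on [U] is equality near each of its points, so the partial derivatives
    agree on [U] as well and the induction goes through. *)
Lemma Ck_on_ext W k U (f g : 'rV[R]_m -> W) :
  open U -> {in U, f =1 g} -> Ck_on k U f -> Ck_on k U g.
Proof.
move=> oU; elim: k f g => [|k IH] f g fg /=.
  move=> cf x Ux; have := cf x Ux; rewrite /prop_for /continuous_at -fg ?inE //.
  apply: cvg_trans; apply: (@near_eq_cvg _ _ (nbhs x)).
  by apply: filterS (open_nbhs_nbhs (conj oU Ux)) => y Uy; apply: fg; rewrite inE.
have fgx x : U x -> {near x, f =1 g}.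
  move=> Ux.
  by apply: filterS (open_nbhs_nbhs (conj oU Ux)) => y Uy; apply: fg; rewrite inE.
case=> df h; split=> [x Ux|i].
  by apply: near_eq_differentiable (df x Ux); exact: fgx.
apply: IH (h i) => x; rewrite inE => Ux; apply: near_eq_derive; exact: fgx.
Qed.

Lemma Ck_onS W k U (f : 'rV[R]_m -> W) : Ck_on k.+1 U f -> Ck_on k U f.
Proof.
elim: k f => [|k IH] f [df h]; first by move=> x /df; exact: differentiable_continuous.
by split=> // i; exact: IH (h i).
Qed.

Lemma Ck_on_cst W k U (a : W) : Ck_on k U (cst a : 'rV[R]_m -> W).
Proof.
elim: k a => [|k IH] a /=; first by move=> x _; exact: cst_continuous.
split=> // i; have -> : (fun x => 'D_(delta_mx 0 i) (cst a) x) = cst 0.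
  by move=> *; apply/funext => x; exact: derive_cst.
exact: IH.
Qed.

Lemma Ck_onD W k U (f g : 'rV[R]_m -> W) :
  open U -> Ck_on k U f -> Ck_on k U g -> Ck_on k U (fun x => f x + g x).
Proof.
move=> oU; elim: k f g => [|k IH] f g /=.
  by move=> cf cg x Ux; apply: (@continuousD _ _ _ f g); [exact: cf|exact: cg].
move=> [df hf] [dg hg]; split=> [x Ux|i].
  by apply: differentiableD; [exact: df|exact: dg].
apply: Ck_on_ext (IH _ _ (hf i) (hg i)) => // x; rewrite inE => Ux.
by rewrite -deriveD //; apply: diff_derivable; [exact: df|exact: dg].
Qed.

Lemma Ck_onZ W k U a (f : 'rV[R]_m -> W) :
  open U -> Ck_on k U f -> Ck_on k U (fun x => a *: f x).
Proof.
move=> oU; elim: k f => [|k IH] f /=.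
  by move=> cf x Ux; apply: continuousZl_tmp; exact: cf.
move=> [df hf]; split=> [x Ux|i].
  by apply: (@differentiableZ _ _ _ f); exact: df.
apply: Ck_on_ext (IH _ (hf i)) => // x; rewrite inE => Ux.
by rewrite -deriveZ //; apply: diff_derivable; exact: df.
Qed.

Lemma Ck_on_sum W k U (n : nat) (f : 'I_n -> 'rV[R]_m -> W) :
  open U -> (forall i, Ck_on k U (f i)) -> Ck_on k U (fun x => \sum_i f i x).
Proof.
move=> oU hf; elim: (index_enum _) => [|i s IH].
  have -> : (fun x => \sum_(i <- [::]) f i x) = cst 0.
    by apply/funext => x; rewrite big_nil.
  exact: Ck_on_cst.
have -> : (fun x => \sum_(j <- i :: s) f j x) =
    (fun x => f i x + \sum_(j <- s) f j x).
  by apply/funext => x; rewrite big_cons.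
exact: Ck_onD.
Qed.

Lemma Ck_onM k U (f g : 'rV[R]_m -> R^o) :
  open U -> Ck_on k U f -> Ck_on k U g ->
  Ck_on k U (fun x => f x * g x : R^o).
Proof.
move=> oU; elim: k f g => [|k IH] f g.
  by move=> cf cg x Ux; apply: (@continuousM _ _ f g); [exact: cf|exact: cg].
move=> hf hg; have [df {}hf'] := hf; have [dg hg'] := hg; split=> [x Ux|i].
  by apply: (@differentiableM _ _ f g); [exact: df|exact: dg].
(* In the Leibniz rule the undifferentiated factor enters with one order of regularity less, hence
   [Ck_onS]. *)
have h := Ck_onD oU (IH _ _ (Ck_onS hf) (hg' i)) (IH _ _ (Ck_onS hg) (hf' i)).
apply: Ck_on_ext h => // x; rewrite inE => Ux.
rewrite [RHS](@deriveM _ _ f g) //.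
- by apply: diff_derivable; exact: df.
- by apply: diff_derivable; exact: dg.
Qed.

Lemma Ck_on_derive W k U (f : 'rV[R]_m -> W) v :
  open U -> Ck_on k.+1 U f -> Ck_on k U (fun x => 'D_v f x).
Proof.
move=> oU [df hf].
apply: (@Ck_on_ext _ _ _ (fun x => \sum_i v 0 i *: 'D_(delta_mx 0 i) f x)) => //.
  by move=> x; rewrite inE => Ux; rewrite -derive_rV_sum //; exact: df.
by apply: Ck_on_sum => // i; exact: Ck_onZ (hf i).
Qed.

Lemma Ck_on_coord k U (p q : nat) (f : 'rV[R]_m -> 'M[R]_(p, q)) i j :
  open U -> Ck_on k U f -> Ck_on k U (fun x => f x i j : R^o).
Proof.
move=> oU; elim: k f => [|k IH] f /=.
  move=> cf x Ux; apply: (@continuous_comp _ _ _ f (fun M => M i j)).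
    exact: cf.
  exact: coord_continuous.
move=> [df hf]; split=> [x Ux|l].
  apply: (@differentiable_comp _ _ _ _ f (fun M => M i j : R^o)); first exact: df.
  exact: differentiable_coord.
apply: Ck_on_ext (IH _ (hf l)) => // x; rewrite inE => Ux.
by rewrite derive_coord //; exact: df.
Qed.

Lemma Ck_on_linear W k U (f : {linear 'rV[R]_m -> W}) : Ck_on k U f.
Proof.
case: k => [|k]; first by move=> x _; exact: linear_rV_continuous.
split=> [x _|i]; first exact: linear_rV_differentiable.
have -> : (fun x => 'D_(delta_mx 0 i) f x) = cst (f (delta_mx 0 i)).
  by apply/funext => x; exact: derive_linear.
exact: Ck_on_cst.
Qed.

End Ck.

(** The direction [l (delta_mx 0 i)] is the same at all points, so a partial derivative of the
    composite is a directional derivative of [f] after the same affine map, and the induction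
    closes. Projections of a product and inclusions of slices have this form. *)
Lemma Ck_on_affine (R : realType) (m p k : nat) (W : normedModType R)
    (U : set 'rV[R]_m) (f : 'rV[R]_m -> W) (b : 'rV[R]_m)
    (l : {linear 'rV[R]_p -> 'rV[R]_m}) :
  open U -> Ck_on k U f ->
  Ck_on k [set x | U (b + l x)] (fun x => f (b + l x)).
Proof.
move=> oU; elim: k f => [|k IH] f.
  move=> cf x Ux; apply: (@continuous_comp _ _ _ (fun x => b + l x) f).
    by apply: continuousD; [exact: cst_continuous|exact: linear_rV_continuous].
  exact: cf.
have dl x : differentiable (fun x => b + l x) x.
  by apply: differentiableD => //; exact: linear_rV_differentiable.
have oV : open [set x | U (b + l x)].
  by apply: open_comp => // x _; apply: differentiable_continuous.
move=> fC; have [df hf] := fC; split=> [x Ux|i].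
  by apply: (@differentiable_comp _ _ _ _ (fun x => b + l x) f) => //; exact: df.
apply: Ck_on_ext (IH _ (Ck_on_derive (l (delta_mx 0 i)) oU fC)) => // x.
rewrite inE => Ux.
rewrite [RHS](@derive_comp _ _ _ _ (fun x => b + l x) f) //; last exact: df.
rewrite (@deriveD _ _ _ (cst b) l) ?derive_cst ?derive_linear ?add0r //.
exact/diff_derivable/linear_rV_differentiable.
Qed.

(** * Symmetry of second derivatives *)

Lemma is_derive_line (R : realType) (V W : normedModType R) (f : V -> W) (z v : V) :
  derivable f z v -> is_derive (0 : R) 1 (fun k : R => f (k *: v + z)) ('D_v f z).
Proof.
move=> df; apply: DeriveDef; first exact: (derivable1P f z v).1 df.
rewrite /derive.
set g1 := (fun h => h^-1 *: _); set g2 := (fun h => h^-1 *: _).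
suff -> : g1 = g2 by [].
by rewrite funeqE /g1 /g2 => h /=; rewrite addr0 scale0r add0r [_%:A]mulr1.
Qed.

(* Young's form of the symmetry of second derivatives: both double limits are
   the limit of the second difference quotient, and no continuity of the second
   derivatives is needed. *)
Lemma second_difference_cvg (R : realType) (V : normedModType R) (f : V -> R^o)
    (x u v : V) :
  (\forall y \near x, derivable f y v) -> differentiable (fun y => 'D_v f y) x ->
  (fun h : R => h^-1 ^+ 2 *
     (f (x + h *: u + h *: v) - f (x + h *: u) - f (x + h *: v) + f x)) @ 0^'
  --> 'D_u (fun y => 'D_v f y) x.
Proof.
move=> nf dg; set g := fun y => 'D_v f y.
set L := 'D_u g x.
(* The remainders of [g] at the two points [x + w1] and [x + w2] below add up to at most [e / c]
   times [|h| (|u| + 2 |v|)]; the [+ 1] keeps [c] positive when [u] and [v] vanish. *)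
pose c : R := 2 * (`|u| + 2 * `|v| + 1).
have c0 : 0 < c by rewrite mulr_gt0 // ltr_wpDl // addr_ge0 // mulr_ge0.
have := diff_locally dg; rewrite -/g => /eqaddoP go.
apply/cvgrPdist_le => e e0.
have ec0 : 0 < e / c by rewrite divr_gt0.
have {go} := go _ ec0; rewrite near_simpl => /nbhs_ballP[r /= r0 gr].
have /nbhs_ballP[s /= s0 fs] := nf.
(* [|h| k] bounds the parallelogram spanned by [h u] and [h v]. Below [min r s], it stays in the
   ball of radius [r], where the expansion of [g] holds, and in that of radius [s], where [f] is
   derivable along [v]. *)
pose k := `|u| + `|v| + 1.
have k0 : 0 < k by rewrite ltr_wpDl // addr_ge0.
have nh : \forall h \near (0 : R)^', `|h| < Num.min r s / k.
  by apply: dnbhs0_lt; rewrite divr_gt0 // lt_min r0.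
near=> h.
have h0 : h != 0 by near: h; exact: nbhs_dnbhs_neq.
have hk : `|h| * k < Num.min r s by rewrite -ltr_pdivlMr //; near: h.
have small (a t : R) : 0 <= a <= 1 -> 0 <= t <= 1 ->
  `|(a * h) *: u + (t * h) *: v| < Num.min r s.
  move=> /andP[a0 a1] /andP[t0 t1]; apply: le_lt_trans hk.
  apply: le_trans (ler_normD _ _) _; rewrite !normrZ. rewrite (ger0_norm a0) (ger0_norm t0).
  rewrite /k !mulrDr mulr1 -addrA lerD //.
    by rewrite -mulrA ler_piMl // mulr_ge0.
  by rewrite -mulrA ler_wpDr // ler_piMl // mulr_ge0.
have gE (a t : R) w : 0 <= a <= 1 -> 0 <= t <= 1 ->
  w = (a * h) *: u + (t * h) *: v ->
  `|g (x + w) - g x - 'd g x w| <= e / c * `|w|.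
  move=> a1 t1 wE; have := gr w; rewrite -ball_normE /= sub0r normrN.
  have ws := small _ _ a1 t1; rewrite -wE in ws.
  have wr : `|w| < r by apply: lt_le_trans ws _; rewrite ge_min lexx.
  move=> /(_ wr); rewrite !fctE /= [w + x]addrC opprD addrA; exact.
(* The increment of [phi] from 0 to 1 is the second difference of [f]; the mean value theorem turns
   it into a first difference of [g] in the direction [u]. *)
pose phi t : R^o := f (x + h *: u + (t * h) *: v) - f (x + (t * h) *: v).
pose dphi t := h * (g (x + h *: u + (t * h) *: v) - g (x + (t * h) *: v)).
have dline (y : V) t : derivable f (y + (t * h) *: v) v ->
   is_derive t 1 (fun t => f (y + (t * h) *: v) : R^o) (h * g (y + (t * h) *: v)).
  set z := y + (t * h) *: v => df.
  have dz : is_derive (0 : R) 1 (fun k : R => f (k *: v + z) : R^o) (g z).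
    exact: is_derive_line.
  (* [is_derive_line] speaks of the parameter 0, so the line is recentred at [t]. *)
  have -> : (fun t => f (y + (t * h) *: v) : R^o) =
      (fun k : R => f (k *: v + z) : R^o) \o (fun k : R => (k - t) * h : R^o).
    apply/funext => l /=; congr f; rewrite /z addrCA -scalerDl -mulrDl.
    by rewrite subrK.
  rewrite mulrC.
  apply: (@is_derive1_comp _ (fun k : R => f (k *: v + z) : R^o) (fun k : R => (k - t) * h)).
    by rewrite subrr mul0r.
  by apply: is_derive_eq; rewrite subr0 subrr scale0r add0r [_ *: _]mulr1.
have dom (t : R) : t \in `[0, 1] -> is_derive t 1 phi (dphi t).
  rewrite in_itv /= => t1.
  rewrite /dphi mulrBr; apply: is_deriveB.
    apply: dline; apply: fs; rewrite -ball_normE /= !opprD !addrA subrr sub0r -opprD normrN.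
    have := @small 1 t; rewrite mul1r lexx ler01 => /(_ isT t1) /lt_le_trans; apply.
    by rewrite ge_min lexx orbT.
  apply: dline; apply: fs; rewrite -ball_normE /= !opprD !addrA subrr sub0r normrN.
  have := @small 0 t; rewrite mul0r scale0r add0r lexx ler01 => /(_ isT t1) /lt_le_trans; apply.
  by rewrite ge_min lexx orbT.
have cphi : {within `[0, 1], continuous phi}.
  by apply: derivable_within_continuous => t /dom [].
have oo (t : R) : t \in `]0, 1[ -> is_derive t 1 phi (dphi t).
  by move/subset_itv_oo_cc; exact: dom.
have [t /subset_itv_oo_cc] := @MVT _ phi dphi 0 1 ltr01 oo cphi.
rewrite in_itv /= => t1.
rewrite /phi /dphi subr0 mulr1 !mul1r !mul0r !scale0r !addr0 => phiE.
rewrite opprB addrA in phiE.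
have -> : f (x + h *: u + h *: v) - f (x + h *: u) - f (x + h *: v) + f x =
  h * (g (x + h *: u + (t * h) *: v) - g (x + (t * h) *: v)).
  by rewrite -phiE; ring.
(* Both values of [g] are expanded at [x]. The linear parts differ by ['d g x (h u)], that is [h L],
   whatever the intermediate [t]; only the two remainders are left to bound. *)
pose w1 := h *: u + (t * h) *: v; pose w2 := (t * h) *: v.
have E1 : `|g (x + w1) - g x - 'd g x w1| <= e / c * `|w1|.
  by apply: (gE 1 t) => //; rewrite ?mul1r // lexx ler01.
have E2 : `|g (x + w2) - g x - 'd g x w2| <= e / c * `|w2|.
  by apply: (gE 0 t) => //; rewrite ?mul0r ?scale0r ?add0r // lexx ler01.
have dw : 'd g x w1 - 'd g x w2 = h * L.
  by rewrite -linearB /w1 /w2 addrK linearZ /L deriveE.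
have w2le : `|w2| <= `|h| * `|v|.
  move: t1 => /andP[t0 t1].
  by rewrite normrZ normrM (ger0_norm t0) ler_wpM2r // ler_piMl.
have w1le : `|w1| <= `|h| * (`|u| + `|v|).
  by rewrite (le_trans (ler_normD _ _)) // normrZ mulrDr lerD.
rewrite -addrA.
have -> : L - h^-1 ^+ 2 * (h * (g (x + w1) - g (x + w2))) =
  - (h^-1 * ((g (x + w1) - g x - 'd g x w1) - (g (x + w2) - g x - 'd g x w2))).
  have -> : L = h^-1 * ('d g x w1 - 'd g x w2) by rewrite dw mulKf.
  by field.
rewrite normrN normrM normfV ler_pdivrMl ?normr_gt0 //.
apply: (le_trans (ler_normB _ _)); apply: (le_trans (lerD E1 E2)).
rewrite -mulrDr mulrAC ler_pdivrMr // -mulrA mulrCA ler_pM2l //.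
apply: (le_trans (lerD w1le w2le)); rewrite -mulrDr ler_wpM2l //.
rewrite /c; have := normr_ge0 u; have := normr_ge0 v; lra.
Unshelve. all: by end_near. Qed.

(** The second difference is symmetric in [u] and [v], and limits are unique. The argument runs
    coordinatewise because [second_difference_cvg] rests on the mean value theorem, which is
    scalar. *)
Lemma derive_sym (R : realType) (V : normedModType R) (n : nat)
    (f : V -> 'rV[R]_n) (x u v : V) :
  (\forall y \near x, differentiable f y) ->
  differentiable (fun y => 'D_u f y) x -> differentiable (fun y => 'D_v f y) x ->
  'D_u (fun y => 'D_v f y) x = 'D_v (fun y => 'D_u f y) x.
Proof.
move=> nf du dv; apply/rowP => j.
apply: etrans (esym (derive_coord u 0 j dv)) _; apply: etrans _ (derive_coord v 0 j du).
pose fj y : R^o := f y 0 j.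
have nfj w : {near x, (fun y => 'D_w fj y) =1 (fun y => 'D_w f y 0 j : R^o)}.
  by apply: filterS nf => y dfy; exact: derive_coord.
have nfj' w : {near x, (fun y => 'D_w f y 0 j : R^o) =1 (fun y => 'D_w fj y)}.
  by apply: filterS (nfj w) => y ->.
apply: etrans (near_eq_derive _ (nfj' v)) _; apply: etrans _ (esym (near_eq_derive _ (nfj' u))).
have dj w : differentiable (fun y => 'D_w f y) x -> differentiable (fun y => 'D_w fj y) x.
  move=> dw; apply: near_eq_differentiable (nfj' w) _.
  apply: (@differentiable_comp _ _ _ _ (fun y => 'D_w f y) (fun M => M 0 j : R^o)) => //.
  exact: differentiable_coord.
have ndj w : \forall y \near x, derivable fj y w.
  apply: filterS nf => y dfy; apply: diff_derivable.
  apply: (@differentiable_comp _ _ _ _ f (fun M => M 0 j : R^o)) => //.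
  exact: differentiable_coord.
have h1 := second_difference_cvg (u := u) (ndj v) (dj v dv).
have h2 := second_difference_cvg (u := v) (ndj u) (dj u du).
rewrite (_ : (fun h : R => _) = (fun h : R => h^-1 ^+ 2 *
  (fj (x + h *: u + h *: v) - fj (x + h *: u) - fj (x + h *: v) + fj x))) in h2.
  exact: (cvg_unique _ h1 h2).
by apply/funext => h; rewrite (addrAC x) (addrAC (fj (x + h *: u + h *: v))).
Qed.

(** * Partial derivatives of functions of a pair, and commuting actions *)

Lemma derive_row_mx (R : realType) (V : normedModType R) (m n : nat)
    (f : V -> 'rV[R]_m) (g : V -> 'rV[R]_n) (x : V) :
  differentiable f x -> differentiable g x ->
  differentiable (fun y => row_mx (f y) (g y)) x /\
  forall v, 'D_v (fun y => row_mx (f y) (g y)) x = row_mx ('D_v f x) ('D_v g x).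
Proof.
move=> df dg.
pose a : 'M[R]_(m, m + n) := row_mx 1%:M 0; pose b : 'M[R]_(n, m + n) := row_mx 0 1%:M.
have E (s : 'rV[R]_m) (t : 'rV[R]_n) : row_mx s t = mulmxr a s + mulmxr b t.
  by rewrite /= !mul_mx_row !mulmx1 !mulmx0 add_row_mx addr0 add0r.
have -> : (fun y => row_mx (f y) (g y)) = (mulmxr a \o f) + (mulmxr b \o g).
  by apply/funext => y; rewrite E.
have da : differentiable (mulmxr a \o f) x.
  by apply: differentiable_comp => //; exact: linear_rV_differentiable.
have db : differentiable (mulmxr b \o g) x.
  by apply: differentiable_comp => //; exact: linear_rV_differentiable.
split=> [|v]; first exact: differentiableD.
rewrite deriveD; [|exact: diff_derivable..].
rewrite (derive_comp _ df) ?(derive_comp _ dg); try exact: linear_rV_differentiable.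
by rewrite !derive_linear E.
Qed.

Lemma derive_row_mxl (R : realType) (m n : nat) (W : normedModType R)
    (f : 'rV[R]_(m + n) -> W) (a : 'rV[R]_m) (b : 'rV[R]_n) :
  differentiable f (row_mx a b) ->
  differentiable (fun x => f (row_mx x b)) a /\
  forall v, 'D_v (fun x => f (row_mx x b)) a = 'D_(row_mx v 0) f (row_mx a b).
Proof.
move=> df.
have did : differentiable (@id 'rV[R]_m) a by [].
have [d D] := derive_row_mx did (differentiable_cst b a).
split=> [|v].
  exact: (@differentiable_comp _ _ _ _ (fun x => row_mx x b) f).
rewrite (@derive_comp _ _ _ _ (fun x => row_mx x b) f) //.
by rewrite D derive_cst derive_id.
Qed.

Lemma derive_row_mxr (R : realType) (m n : nat) (W : normedModType R)
    (f : 'rV[R]_(m + n) -> W) (a : 'rV[R]_m) (b : 'rV[R]_n) :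
  differentiable f (row_mx a b) ->
  differentiable (fun x => f (row_mx a x)) b /\
  forall v, 'D_v (fun x => f (row_mx a x)) b = 'D_(row_mx 0 v) f (row_mx a b).
Proof.
move=> df.
have did : differentiable (@id 'rV[R]_n) b by [].
have [d D] := derive_row_mx (differentiable_cst a b) did.
split=> [|v].
  exact: (@differentiable_comp _ _ _ _ (fun x => row_mx a x) f).
rewrite (@derive_comp _ _ _ _ (fun x => row_mx a x) f) //.
by rewrite D derive_cst derive_id.
Qed.

(* With [m1 (q, t) = q t] and [m2 (s, q) = s q], both sides are mixed second
   derivatives of [(s, t) |-> s q t]. *)
Lemma derive_commuting_actions (R : realType) (n p : nat)
    (m1 : 'rV[R]_(n + p) -> 'rV[R]_n) (m2 : 'rV[R]_(p + n) -> 'rV[R]_n)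
    (q : 'rV[R]_n) (e : 'rV[R]_p) (v w : 'rV[R]_p) :
  m1 (row_mx q e) = q -> m2 (row_mx e q) = q ->
  (\forall y \near row_mx q e, differentiable m1 y) ->
  (\forall y \near row_mx e q, differentiable m2 y) ->
  differentiable (fun y => 'D_(row_mx 0 w) m1 y) (row_mx q e) ->
  differentiable (fun y => 'D_(row_mx v 0) m2 y) (row_mx e q) ->
  (\forall y \near row_mx e e,
     m1 (row_mx (m2 (row_mx (lsubmx y) q)) (rsubmx y)) =
     m2 (row_mx (lsubmx y) (m1 (row_mx q (rsubmx y))))) ->
  'D_('D_(row_mx v 0) m2 (row_mx e q))
     (fun x => 'D_(row_mx 0 w) m1 (row_mx x e)) q =
  'D_('D_(row_mx 0 w) m1 (row_mx q e))
     (fun x => 'D_(row_mx v 0) m2 (row_mx e x)) q.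
Proof.
move=> m1q m2q dm1 dm2 ddm1 ddm2 comm.
(* With y = (s, t): [F1] is s q and [F2] is q t, while [A1] is (s q, t) and [A2] is (s, q t). Hence
   [m1 \o A1] is (s q) t and [m2 \o A2] is s (q t). *)
pose F1 (y : 'rV[R]_(p + p)) := m2 (row_mx (lsubmx y) q).
pose F2 (y : 'rV[R]_(p + p)) := m1 (row_mx q (rsubmx y)).
pose A1 y : 'rV[R]_(n + p) := row_mx (F1 y) (rsubmx y).
pose A2 y : 'rV[R]_(p + n) := row_mx (lsubmx y) (F2 y).
pose y0 : 'rV[R]_(p + p) := row_mx e e.
have A1y0 : A1 y0 = row_mx q e by rewrite /A1 /F1 /y0 row_mxKl row_mxKr m2q.
have A2y0 : A2 y0 = row_mx e q by rewrite /A2 /F2 /y0 row_mxKl row_mxKr m1q.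
have dl y : differentiable (lsubmx : 'rV[R]_(p + p) -> 'rV[R]_p) y.
  exact: differentiable_lsubmx.
have dr y : differentiable (rsubmx : 'rV[R]_(p + p) -> 'rV[R]_p) y.
  exact: differentiable_rsubmx.
have Dl y z : 'D_z (lsubmx : 'rV[R]_(p + p) -> 'rV[R]_p) y = lsubmx z.
  exact: derive_linear.
have Dr y z : 'D_z (rsubmx : 'rV[R]_(p + p) -> 'rV[R]_p) y = rsubmx z.
  exact: derive_linear.
have DA1 y : differentiable m2 (row_mx (lsubmx y) q) -> differentiable A1 y /\
  forall z, 'D_z A1 y =
    row_mx ('D_(row_mx (lsubmx z) 0) m2 (row_mx (lsubmx y) q)) (rsubmx z).
  move=> /derive_row_mxl[d D].
  have d' : differentiable F1 y.
    exact: (@differentiable_comp _ _ _ _ lsubmx (fun x => m2 (row_mx x q))).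
  have D' z : 'D_z F1 y = 'D_(row_mx (lsubmx z) 0) m2 (row_mx (lsubmx y) q).
    rewrite -D -(Dl y).
    exact: (@derive_comp _ _ _ _ lsubmx (fun x => m2 (row_mx x q))).
  have [dA DA] := @derive_row_mx _ _ _ _ F1 rsubmx y d' (dr y); split=> [|z].
    exact: dA.
  by rewrite /A1 DA D' Dr.
have DA2 y : differentiable m1 (row_mx q (rsubmx y)) -> differentiable A2 y /\
  forall z, 'D_z A2 y =
    row_mx (lsubmx z) ('D_(row_mx 0 (rsubmx z)) m1 (row_mx q (rsubmx y))).
  move=> /derive_row_mxr[d D].
  have d' : differentiable F2 y.
    exact: (@differentiable_comp _ _ _ _ rsubmx (fun x => m1 (row_mx q x))).
  have D' z : 'D_z F2 y = 'D_(row_mx 0 (rsubmx z)) m1 (row_mx q (rsubmx y)).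
    rewrite -D -(Dr y).
    exact: (@derive_comp _ _ _ _ rsubmx (fun x => m1 (row_mx q x))).
  have [dA DA] := @derive_row_mx _ _ _ _ lsubmx F2 y (dl y) d'; split=> [|z].
    exact: dA.
  by rewrite /A2 DA D' Dl.
have near2 : \forall y \near y0, differentiable m2 (row_mx (lsubmx y) q).
  have c : {for y0, continuous (fun y : 'rV[R]_(p + p) => row_mx (lsubmx y) q)}.
    apply: differentiable_continuous.
    by have [] := derive_row_mx (dl y0) (differentiable_cst q y0).
  have h : nbhs (row_mx (lsubmx y0) q) (fun z => differentiable m2 z).
    by rewrite /y0 row_mxKl.
  exact: c h.
have near1 : \forall y \near y0, differentiable m1 (row_mx q (rsubmx y)).
  have c : {for y0, continuous (fun y : 'rV[R]_(p + p) => row_mx q (rsubmx y))}.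
    apply: differentiable_continuous.
    by have [] := derive_row_mx (differentiable_cst q y0) (dr y0).
  have h : nbhs (row_mx q (rsubmx y0)) (fun z => differentiable m1 z).
    by rewrite /y0 row_mxKr.
  exact: c h.
have [dA1 DA1y0] := DA1 _ (nbhs_singleton near2).
have [dA2 DA2y0] := DA2 _ (nbhs_singleton near1).
have near1' : \forall y \near y0, differentiable m1 (A1 y).
  have h : nbhs (A1 y0) (fun z => differentiable m1 z) by rewrite A1y0.
  exact: (differentiable_continuous dA1 h).
have near2' : \forall y \near y0, differentiable m2 (A2 y).
  have h : nbhs (A2 y0) (fun z => differentiable m2 z) by rewrite A2y0.
  exact: (differentiable_continuous dA2 h).
pose psi := m1 \o A1.
have dpsi : \forall y \near y0, differentiable psi y.
  apply: filterS2 near2 near1' => y d2 d1.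
  by apply: differentiable_comp => //; have [] := DA1 _ d2.
have Dw : {near y0, (fun y => 'D_(row_mx 0 w) m1 (A1 y)) =1
                    (fun y => 'D_(row_mx 0 w) psi y)}.
  apply: filterS2 near2 near1' => y d2 d1; have [dA DA] := DA1 _ d2.
  apply: etrans _ (esym (derive_comp _ dA d1)).
  by rewrite DA row_mxKl row_mxKr row_mx0 derive0.
have Dv : {near y0, (fun y => 'D_(row_mx v 0) m2 (A2 y)) =1
                    (fun y => 'D_(row_mx v 0) psi y)}.
  (* A derivative at [y] needs the two products to agree near [y], not only at [y]; [nbhs_interior]
     provides this for all [y] close to [y0]. *)
  apply: filterS3 near1 near2' (nbhs_interior comm) => y d1 d2 ncomm.
  have [dA DA] := DA2 _ d1.
  have psiE : {near y, (m2 \o A2) =1 psi}.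
    by apply: filterS ncomm => t /esym.
  apply: etrans _ (near_eq_derive _ psiE).
  apply: etrans _ (esym (derive_comp _ dA d2)).
  by rewrite DA row_mxKl row_mxKr row_mx0 derive0.
have ddw : differentiable (fun y => 'D_(row_mx 0 w) m1 (A1 y)) y0.
  apply: (@differentiable_comp _ _ _ _ A1 (fun y => 'D_(row_mx 0 w) m1 y)) => //.
  by rewrite A1y0.
have ddv : differentiable (fun y => 'D_(row_mx v 0) m2 (A2 y)) y0.
  apply: (@differentiable_comp _ _ _ _ A2 (fun y => 'D_(row_mx v 0) m2 y)) => //.
  by rewrite A2y0.
have sym := derive_sym dpsi (near_eq_differentiable Dv ddv)
                            (near_eq_differentiable Dw ddw).
have [_ ->] := derive_row_mxl ddm1; have [_ ->] := derive_row_mxr ddm2.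
(* Moving s along [v] moves [A1] away from (q, e) in the direction of the first factor, by the
   derivative of [m2]. So the left side is the s-derivative of the t-derivative of [psi], and the
   right side is the opposite order, through [A2]. *)
pose G1 y := 'D_(row_mx 0 w) m1 y; pose G2 y := 'D_(row_mx v 0) m2 y.
have E1 : 'D_(row_mx v 0) A1 y0 = row_mx ('D_(row_mx v 0) m2 (row_mx e q)) 0.
  by apply: etrans (DA1y0 _) _; rewrite /y0 !row_mxKl row_mxKr.
have E2 : 'D_(row_mx 0 w) A2 y0 = row_mx 0 ('D_(row_mx 0 w) m1 (row_mx q e)).
  by apply: etrans (DA2y0 _) _; rewrite /y0 !row_mxKr row_mxKl.
have dG1 : differentiable G1 (A1 y0) by rewrite A1y0.
have dG2 : differentiable G2 (A2 y0) by rewrite A2y0.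
have L1 : 'D_(row_mx v 0) (G1 \o A1) y0 =
    'D_(row_mx ('D_(row_mx v 0) m2 (row_mx e q)) 0) G1 (row_mx q e).
  apply: etrans (derive_comp _ dA1 dG1) _.
  exact: (f_equal2 (fun x z => 'D_z G1 x) A1y0 E1).
have L2 : 'D_(row_mx 0 w) (G2 \o A2) y0 =
    'D_(row_mx 0 ('D_(row_mx 0 w) m1 (row_mx q e))) G2 (row_mx e q).
  apply: etrans (derive_comp _ dA2 dG2) _.
  exact: (f_equal2 (fun x z => 'D_z G2 x) A2y0 E2).
rewrite -/G1 -/G2 -L1 -L2.
have L3 : 'D_(row_mx v 0) (G1 \o A1) y0 = 'D_(row_mx v 0) (fun y => 'D_(row_mx 0 w) psi y) y0.
  exact: near_eq_derive _ Dw.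
have L4 : 'D_(row_mx 0 w) (G2 \o A2) y0 = 'D_(row_mx 0 w) (fun y => 'D_(row_mx v 0) psi y) y0.
  exact: near_eq_derive _ Dv.
rewrite L3 L4; exact: sym.
Qed.

(** * Momentum functions on R^(2n) *)

Section Momentum.
Variables (R : realType) (n : nat).
Implicit Types (X Y : 'rV[R]_n -> 'rV[R]_n) (y z : 'rV[R]_(n + n)).
Implicit Types (f g : 'rV[R]_(n + n) -> R^o).

Lemma pairingE (p v : 'rV[R]_n) : pairing p v = \sum_i p 0 i * v 0 i.
Proof. by rewrite /pairing mxE; apply: eq_bigr => i _; rewrite mxE. Qed.

Lemma pairingNl (p v : 'rV[R]_n) : pairing (- p) v = - pairing p v.
Proof. by rewrite /pairing mulNmx mxE. Qed.

Lemma pairing_row (y z : 'rV[R]_(n + n)) :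
  pairing y z = pairing (lsubmx y) (lsubmx z) + pairing (rsubmx y) (rsubmx z).
Proof.
by rewrite /pairing -{1}[y]hsubmxK -{1}[z]hsubmxK tr_row_mx mul_row_col mxE.
Qed.

Definition momentum X y : R^o := pairing (rsubmx y) (X (lsubmx y)).

Lemma Ck_on_momentum k (U : set 'rV[R]_n) X :
  open U -> Ck_on k U X -> Ck_on k [set y | U (lsubmx y)] (momentum X).
Proof.
move=> oU CX.
have oV : open [set y : 'rV[R]_(n + n) | U (lsubmx y)].
  by apply: open_comp => // y _; exact: continuous_lsubmx.
have CXl : Ck_on k [set y : 'rV[R]_(n + n) | U (lsubmx y)] (fun y => X (lsubmx y)).
  have /= := Ck_on_affine 0 (lsubmx : {linear 'rV[R]_(n + n) -> 'rV[R]_n}) oU CX.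
  have -> : [set y : 'rV[R]_(n + n) | U (0 + lsubmx y)] = [set y | U (lsubmx y)].
    by apply/seteqP; split=> y /=; rewrite add0r.
  by apply: Ck_on_ext => // y _ /=; rewrite add0r.
have C1 i := Ck_on_coord 0 i oV CXl.
have C2 i := Ck_on_coord 0 i oV (Ck_on_linear k [set y | U (lsubmx y)]
   (rsubmx : {linear 'rV[R]_(n + n) -> 'rV[R]_n})).
apply: Ck_on_ext (Ck_on_sum oV (fun i => Ck_onM oV (C2 i) (C1 i))) => // y _.
by rewrite /momentum pairingE.
Qed.

Lemma derive_momentum X y :
  differentiable X (lsubmx y) ->
  differentiable (momentum X) y /\
  forall z, 'D_z (momentum X) y =
    pairing (rsubmx z) (X (lsubmx y)) +
    pairing (rsubmx y) ('D_(lsubmx z) X (lsubmx y)).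
Proof.
move=> dX.
have dl : differentiable (lsubmx : 'rV[R]_(n + n) -> 'rV[R]_n) y.
  exact: differentiable_lsubmx.
have dr : differentiable (rsubmx : 'rV[R]_(n + n) -> 'rV[R]_n) y.
  exact: differentiable_rsubmx.
pose Xl (z : 'rV[R]_(n + n)) := X (lsubmx z).
have dXl : differentiable Xl y by exact: (@differentiable_comp _ _ _ _ lsubmx X).
have DXl z : 'D_z Xl y = 'D_(lsubmx z) X (lsubmx y).
  apply: etrans (derive_comp _ dl dX) _.
  by rewrite (@derive_linear _ _ _ (lsubmx : {linear 'rV[R]_(n + n) -> 'rV[R]_n})).
pose a i (z : 'rV[R]_(n + n)) : R^o := rsubmx z 0 i.
pose b i (z : 'rV[R]_(n + n)) : R^o := Xl z 0 i.
have da i : differentiable (a i) y.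
  apply: (@differentiable_comp _ _ _ _ rsubmx (fun M : 'rV[R]_n => M 0 i : R^o)) => //.
  exact: differentiable_coord.
have db i : differentiable (b i) y.
  apply: (@differentiable_comp _ _ _ _ Xl (fun M : 'rV[R]_n => M 0 i : R^o)) => //.
  exact: differentiable_coord.
have mE : momentum X = \sum_i (a i * b i).
  by apply/funext => z; rewrite /momentum pairingE fct_sumE.
split=> [|z].
  by rewrite mE; apply: differentiable_sum => i; exact: differentiableM.
have dab i : derivable (a i * b i) y z by apply: derivableM; exact: diff_derivable.
rewrite mE derive_sum // !pairingE -big_split; apply: eq_bigr => i _ /=.
rewrite deriveM; [|exact: diff_derivable..].
rewrite [RHS]addrC; congr (_ + _).
  congr (_ * _); apply: etrans (derive_coord z 0 i dXl) _.
  by rewrite DXl.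
rewrite [RHS]mulrC; congr (_ * _); apply: etrans (derive_coord z 0 i dr) _.
by rewrite (@derive_linear _ _ _ (rsubmx : {linear 'rV[R]_(n + n) -> 'rV[R]_n})).
Qed.

(** [differential] and [hamiltonian_vf] on R^(2n): at a point z of T^*M those two are, by
    conversion, this gradient and the next one for the function read in the canonical chart at z. *)
Definition gradient f y : 'rV[R]_(n + n) := \row_i 'D_(delta_mx 0 i) f y.

Definition symplectic_gradient f y : 'rV[R]_(n + n) :=
  row_mx (rsubmx (gradient f y)) (- lsubmx (gradient f y)).

Lemma pairing_gradient f y z :
  differentiable f y -> pairing (gradient f y) z = 'D_z f y.
Proof.
move=> df; rewrite (derive_rV_sum z df) /pairing mxE; apply: eq_bigr => i _.
by rewrite !mxE mulrC.
Qed.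

Lemma symplectic_gradientE f y z : differentiable f y ->
  symplectic_form (symplectic_gradient f y) z = 'D_z f y.
Proof.
move=> df; rewrite -(pairing_gradient z df) /symplectic_form /symplectic_gradient.
rewrite row_mxKl row_mxKr pairingNl opprK addrC pairing_row.
congr (_ + _); rewrite !pairingE; apply: eq_bigr => i _; exact: mulrC.
Qed.

Lemma rsubmx_gradient_momentum X y : differentiable X (lsubmx y) ->
  rsubmx (gradient (momentum X) y) = X (lsubmx y).
Proof.
move=> dX; have [dmX DmX] := derive_momentum dX.
apply/rowP => i; rewrite !mxE DmX.
have -> : delta_mx 0 (rshift n i) = row_mx 0 (delta_mx 0 i) :> 'rV[R]_(n + n).
  apply/rowP => j; rewrite !mxE; case: splitP => k jk; rewrite !mxE eqxx /=.
    by rewrite (_ : j = lshift n k) ?eq_lrshift //; exact: val_inj.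
  by rewrite (_ : j = rshift n k) ?eq_rshift //; exact: val_inj.
rewrite row_mxKl row_mxKr derive0 [X in _ + X]/pairing trmx0 mulmx0 mxE addr0.
by rewrite /pairing -rowE !mxE.
Qed.

(** Up to sign, momenta turn the Lie bracket of vector fields into the Poisson bracket: in
    coordinates [X, Y] is D_X Y - D_Y X. The Hamiltonian vector field of p.Y has q-part Y, which
    gives the first term, and p-part minus the q-gradient of p.Y, which gives the second. *)
Lemma symplectic_form_momentum X Y y :
  differentiable X (lsubmx y) -> differentiable Y (lsubmx y) ->
  symplectic_form (symplectic_gradient (momentum X) y)
                  (symplectic_gradient (momentum Y) y) =
  pairing (rsubmx y) ('D_(Y (lsubmx y)) X (lsubmx y)
                      - 'D_(X (lsubmx y)) Y (lsubmx y)).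
Proof.
move=> dX dY; have [dmX DmX] := derive_momentum dX.
have [dmY DmY] := derive_momentum dY.
rewrite symplectic_gradientE // DmX /symplectic_gradient row_mxKl row_mxKr.
rewrite (rsubmx_gradient_momentum dY) pairingNl.
have -> : pairing (lsubmx (gradient (momentum Y) y)) (X (lsubmx y)) =
    pairing (rsubmx y) ('D_(X (lsubmx y)) Y (lsubmx y)).
  have := pairing_gradient (row_mx (X (lsubmx y)) 0) dmY.
  rewrite DmY pairing_row row_mxKl row_mxKr.
  by rewrite {2}/pairing trmx0 mulmx0 mxE addr0 {2}/pairing mul0mx mxE add0r.
by rewrite addrC /pairing (raddfB trmx) mulmxBr !mxE.
Qed.

(** Pairing Hamiltonian vector fields with a fixed [u] is a derivation in the function, so a
    quadratic form in functions that it kills is killed too. *)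
Lemma symplectic_form_quadratic (I : nat) (f : 'I_I -> _) (Q : 'M[R]_I) y u :
  (forall a, differentiable (f a) y) ->
  (forall a, symplectic_form (symplectic_gradient (f a) y) u = 0) ->
  differentiable (fun z => \sum_a \sum_b Q a b * (f a z * f b z) : R^o) y /\
  symplectic_form (symplectic_gradient
    (fun z => \sum_a \sum_b Q a b * (f a z * f b z) : R^o) y) u = 0.
Proof.
move=> df fu.
have Du a : 'D_u (f a) y = 0 by rewrite -symplectic_gradientE.
have dff a b : differentiable (f a * f b) y by exact: differentiableM.
have dQ a b : differentiable (Q a b *: (f a * f b)) y by exact: differentiableZ.
have dS a : differentiable (\sum_b Q a b *: (f a * f b)) y.
  exact: differentiable_sum.
have E : (fun z => \sum_a \sum_b Q a b * (f a z * f b z) : R^o) =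
    \sum_a \sum_b Q a b *: (f a * f b).
  apply/funext => z; rewrite fct_sumE; apply: eq_bigr => a _.
  by rewrite fct_sumE.
rewrite E; have dE := differentiable_sum dS; split=> //.
rewrite symplectic_gradientE // derive_sum => [|a]; last exact: diff_derivable.
rewrite big1 // => a _; rewrite derive_sum => [|b]; last exact: diff_derivable.
rewrite big1 // => b _; rewrite deriveZ; last exact: diff_derivable.
by rewrite deriveM ?Du ?scaler0 ?addr0 ?scaler0 //; exact: diff_derivable.
Qed.

End Momentum.

(** * Jacobians in charts *)

(** Both charts are free, whereas [tangent_map] imposes [chart_at] on either side; a single chart
    can thus be kept over a neighbourhood. The case [f = id] is [coord_change]. *)
Definition chart_jacobian (R : realType) (n : nat) (M : Type) (C : atlas R n M)
    (c d : chart C) (f : M -> M) (x : M) : 'M[R]_n :=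
  jacobian (chart_map d \o f \o chart_inv c) (chart_map c x).

Definition chart_differentiable (R : realType) (n : nat) (M : Type)
    (C : atlas R n M) (c d : chart C) (f : M -> M) (x : M) :=
  differentiable (chart_map d \o f \o chart_inv c) (chart_map c x).

Section Manifold.
Variables (R : realType) (n : nat) (M : topologicalType) (C : atlas R n M).
Hypothesis MC : smooth_manifold C.
Implicit Types (c d e : chart C) (f g : M -> M) (x : M).

Lemma chart_cod_map c x : chart_dom c x -> chart_cod c (chart_map c x).
Proof. by move=> cx; exists x. Qed.

Lemma chart_dom_inv c q : chart_cod c q -> chart_dom c (chart_inv c q).
Proof. by case=> x cx <-; rewrite (chart_mapK MC). Qed.

Lemma chart_invK c q : chart_cod c q -> chart_map c (chart_inv c q) = q.
Proof. by case=> x cx <-; rewrite (chart_mapK MC). Qed.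

Lemma chart_cod_near c q : chart_cod c q -> \forall p \near q, chart_cod c p.
Proof. by move=> cq; apply: open_nbhs_nbhs; split=> //; exact: open_chart_cod. Qed.

Lemma chart_inv_near c q (U : set M) :
  chart_cod c q -> nbhs (chart_inv c q) U -> \forall p \near q, U (chart_inv c p).
Proof. by move=> cq; exact: (chart_inv_continuous MC cq). Qed.

(** Continuity of [f] at [x] keeps nearby values of [f] in [chart_dom d], where [chart_inv d] undoes
    [chart_map d]. The composite of the local expressions is then the local expression of the
    composite near [chart_map c x], and the chain rule applies. *)
Lemma chart_jacobian_comp c d e f g x :
  chart_dom c x -> chart_dom d (f x) -> {for x, continuous f} ->
  chart_differentiable c d f x -> chart_differentiable d e g (f x) ->
  chart_differentiable c e (g \o f) x /\
  chart_jacobian c e (g \o f) x =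
    chart_jacobian c d f x *m chart_jacobian d e g (f x).
Proof.
move=> cx dfx cf df dg.
pose lf := chart_map d \o f \o chart_inv c.
pose lg := chart_map e \o g \o chart_inv d.
pose q := chart_map c x.
have lfq : lf q = chart_map d (f x) by rewrite /lf /q /= (chart_mapK MC).
have dlg : differentiable lg (lf q) by rewrite lfq.
have dlgf : differentiable (lg \o lf) q by exact: differentiable_comp.
have E : {near q, lg \o lf =1 chart_map e \o (g \o f) \o chart_inv c}.
  have nd : \forall p \near q, chart_dom d (f (chart_inv c p)).
    apply: (@chart_inv_near c q (f @^-1` chart_dom d)); first exact: chart_cod_map.
    rewrite (chart_mapK MC) //; apply: cf; apply: open_nbhs_nbhs; split=> //.
    exact: open_chart_dom.
  by apply: filterS nd => p dp; rewrite /lg /lf /= (chart_mapK MC).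
have dgf : chart_differentiable c e (g \o f) x by exact: near_eq_differentiable E dlgf.
split=> //; apply: etrans (esym (near_eq_jacobian dlgf dgf E)) _.
by apply: etrans (@jacobian_comp _ _ _ _ lf lg q df dlg) _; rewrite lfq.
Qed.

Lemma chart_differentiable_id c d x :
  chart_dom c x -> chart_dom d x -> chart_differentiable c d id x.
Proof.
move=> cx dx; have [h _] := transition_smooth MC c d 1%N.
by apply: h; exists x.
Qed.

Lemma chart_jacobian_id c x :
  chart_dom c x -> chart_differentiable c c id x /\ chart_jacobian c c id x = 1%:M.
Proof.
move=> cx; have d := chart_differentiable_id cx cx; split=> //.
have did : differentiable (@id 'rV[R]_n) (chart_map c x) by [].
have E : {near chart_map c x, @id 'rV[R]_n =1 chart_map c \o id \o chart_inv c}.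
  by apply: filterS (chart_cod_near (chart_cod_map cx)) => p cp /=; rewrite chart_invK.
apply: etrans (esym (near_eq_jacobian did d E)) _.
apply/row_matrixP => i; apply: etrans (row_jacobian i did) _.
by rewrite row1 derive_id.
Qed.

End Manifold.

(** * Group multiplication and translations in charts *)

Section LieGroup.
Variables (R : realType) (n : nat) (G : groupTopologicalType) (C : atlas R n G).
Hypothesis GC : lie_group C.
Implicit Types (c d : chart C) (x : G).

Let MC : smooth_manifold C := lie_group_manifold GC.

Lemma continuous_mulg (T : topologicalType) (f g : T -> G) (y : T) :
  {for y, continuous f} -> {for y, continuous g} ->
  {for y, continuous (fun z => f z * g z)%g}.
Proof.
move=> cf cg; have [cm _] := lie_group_mul_smooth GC.
apply: (@continuous_comp _ _ _ (fun z => (f z, g z)) (fun gh : G * G => (gh.1 * gh.2)%g)).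
  exact: (cvg_pair cf cg).
exact: cm.
Qed.

Definition chart_mul c1 c2 d (y : 'rV[R]_(n + n)) : 'rV[R]_n :=
  chart_map d (chart_inv c1 (lsubmx y) * chart_inv c2 (rsubmx y))%g.

Definition chart_mul_dom c1 c2 d : set 'rV[R]_(n + n) :=
  [set y | [/\ chart_cod c1 (lsubmx y), chart_cod c2 (rsubmx y) &
    chart_dom d (chart_inv c1 (lsubmx y) * chart_inv c2 (rsubmx y))%g]].

Lemma open_chart_mul_dom c1 c2 d : open (chart_mul_dom c1 c2 d).
Proof.
rewrite openE => y [c1y c2y dy].
have n1 : \forall z \near y, chart_cod c1 (lsubmx z).
  exact: (continuous_lsubmx (chart_cod_near MC c1y)).
have n2 : \forall z \near y, chart_cod c2 (rsubmx z).
  exact: (continuous_rsubmx (chart_cod_near MC c2y)).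
have n3 : \forall z \near y,
    chart_dom d (chart_inv c1 (lsubmx z) * chart_inv c2 (rsubmx z))%g.
  have cm : {for y, continuous (fun z : 'rV[R]_(n + n) =>
      chart_inv c1 (lsubmx z) * chart_inv c2 (rsubmx z))%g}.
    apply: continuous_mulg.
      apply: (@continuous_comp _ _ _ lsubmx (chart_inv c1)).
        exact: continuous_lsubmx.
      exact: chart_inv_continuous.
    apply: (@continuous_comp _ _ _ rsubmx (chart_inv c2)).
      exact: continuous_rsubmx.
    exact: chart_inv_continuous.
  by apply: cm; apply: open_nbhs_nbhs; split=> //; exact: open_chart_dom.
by apply: filterS3 n1 n2 n3 => z.
Qed.

Lemma smooth_chart_mul c1 c2 d : smooth_on (chart_mul_dom c1 c2 d) (chart_mul c1 c2 d).
Proof.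
have [_ sm] := lie_group_mul_smooth GC => k.
apply: Ck_on_sub (sm (c1, c2) d k) => y [c1y c2y dy].
exists (chart_inv c1 (lsubmx y), chart_inv c2 (rsubmx y)).
  by split=> //; split; exact: (chart_dom_inv MC).
by rewrite /= !(chart_invK MC) // hsubmxK.
Qed.

Lemma chart_mul_domP c1 c2 d x1 x2 :
  chart_dom c1 x1 -> chart_dom c2 x2 -> chart_dom d (x1 * x2)%g ->
  chart_mul_dom c1 c2 d (row_mx (chart_map c1 x1) (chart_map c2 x2)).
Proof.
move=> c1x c2x dx; split; rewrite ?row_mxKl ?row_mxKr; try exact: chart_cod_map.
by rewrite !(chart_mapK MC).
Qed.

Lemma differentiable_chart_mul c1 c2 d y :
  chart_mul_dom c1 c2 d y -> differentiable (chart_mul c1 c2 d) y.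
Proof. by move=> Uy; have [h _] := @smooth_chart_mul c1 c2 d 1%N; exact: h. Qed.

Lemma Ck_on_derive_chart_mul k c1 c2 d v :
  Ck_on k (chart_mul_dom c1 c2 d) (fun y => 'D_v (chart_mul c1 c2 d) y).
Proof.
apply: Ck_on_derive; first exact: open_chart_mul_dom.
exact: smooth_chart_mul.
Qed.

Lemma differentiable_derive_chart_mul c1 c2 d v y :
  chart_mul_dom c1 c2 d y -> differentiable (fun y => 'D_v (chart_mul c1 c2 d) y) y.
Proof. by move=> Uy; have [h _] := Ck_on_derive_chart_mul 1 c1 c2 d v; exact: h. Qed.

Lemma near_chart_mul_dom c1 c2 d y :
  chart_mul_dom c1 c2 d y -> \forall z \near y, chart_mul_dom c1 c2 d z.
Proof.
by move=> Uy; apply: open_nbhs_nbhs; split=> //; exact: open_chart_mul_dom.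
Qed.

Let dom_at x : chart_dom (chart_at C x) x := chart_at_dom MC x.

(** In charts, the translation is [chart_mul] with one argument frozen at the coordinates of [g].
    Any chart [b] around [g] serves for the rows; differentiability does not mention [b] and is
    taken from [chart_at C g]. *)
Lemma left_mul_jacobian g c d x :
  chart_dom c x -> chart_dom d (g * x)%g ->
  chart_differentiable c d (fun h => g * h)%g x /\
  forall b i, chart_dom b g -> row i (chart_jacobian c d (fun h => g * h)%g x) =
    'D_(row_mx 0 (delta_mx 0 i)) (chart_mul b c d) (row_mx (chart_map b g) (chart_map c x)).
Proof.
move=> cx dgx.
have h b : chart_dom b g -> chart_differentiable c d (fun h => g * h)%g x /\
  forall i, row i (chart_jacobian c d (fun h => g * h)%g x) =
    'D_(row_mx 0 (delta_mx 0 i)) (chart_mul b c d) (row_mx (chart_map b g) (chart_map c x)).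
  move=> bg; have E : chart_map d \o (fun h => g * h)%g \o chart_inv c =
      (fun q => chart_mul b c d (row_mx (chart_map b g) q)).
    apply/funext => q; rewrite /chart_mul row_mxKl row_mxKr /=.
    by rewrite (chart_mapK MC).
  have dm := differentiable_chart_mul (chart_mul_domP bg cx dgx).
  have [dm' Dm] := derive_row_mxr dm.
  rewrite /chart_differentiable /chart_jacobian E; split=> // i.
  exact: etrans (row_jacobian i dm') (Dm _).
have [dL _] := h _ (dom_at g); split=> // b i bg.
by have [_ ->] := h _ bg.
Qed.

Lemma right_mul_jacobian g c d x :
  chart_dom c x -> chart_dom d (x * g)%g ->
  chart_differentiable c d (fun h => h * g)%g x /\
  forall b i, chart_dom b g -> row i (chart_jacobian c d (fun h => h * g)%g x) =
    'D_(row_mx (delta_mx 0 i) 0) (chart_mul c b d) (row_mx (chart_map c x) (chart_map b g)).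
Proof.
move=> cx dgx.
have h b : chart_dom b g -> chart_differentiable c d (fun h => h * g)%g x /\
  forall i, row i (chart_jacobian c d (fun h => h * g)%g x) =
    'D_(row_mx (delta_mx 0 i) 0) (chart_mul c b d) (row_mx (chart_map c x) (chart_map b g)).
  move=> bg; have E : chart_map d \o (fun h => h * g)%g \o chart_inv c =
      (fun q => chart_mul c b d (row_mx q (chart_map b g))).
    apply/funext => q; rewrite /chart_mul row_mxKl row_mxKr /=.
    by rewrite (chart_mapK MC).
  have dm := differentiable_chart_mul (chart_mul_domP cx bg dgx).
  have [dm' Dm] := derive_row_mxl dm.
  rewrite /chart_differentiable /chart_jacobian E; split=> // i.
  exact: etrans (row_jacobian i dm') (Dm _).
have [dL _] := h _ (dom_at g); split=> // b i bg.
by have [_ ->] := h _ bg.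
Qed.

Lemma continuous_left_mul g : continuous (fun h : G => g * h)%g.
Proof. by move=> h; apply: continuous_mulg => //; exact: cst_continuous. Qed.

Lemma continuous_right_mul g : continuous (fun h : G => h * g)%g.
Proof. by move=> h; apply: continuous_mulg => //; exact: cst_continuous. Qed.

Lemma left_mul_jacobianV c d g x :
  chart_dom c x -> chart_dom d (g * x)%g ->
  chart_jacobian c d (fun h => g * h)%g x *m
    chart_jacobian d c (fun h => g^-1 * h)%g (g * x)%g = 1%:M.
Proof.
move=> cx dgx; have cx' : chart_dom c (g^-1 * (g * x))%g by rewrite mulKg.
have [dL _] := left_mul_jacobian cx dgx; have [dL' _] := left_mul_jacobian dgx cx'.
have [_ <-] := chart_jacobian_comp MC cx dgx (@continuous_left_mul g x) dL dL'.
rewrite (_ : _ \o _ = id); first by have [] := chart_jacobian_id MC cx.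
by apply/funext => h /=; rewrite mulKg.
Qed.

Lemma right_mul_jacobianV c d g x :
  chart_dom c x -> chart_dom d (x * g)%g ->
  chart_jacobian c d (fun h => h * g)%g x *m
    chart_jacobian d c (fun h => h * g^-1)%g (x * g)%g = 1%:M.
Proof.
move=> cx dgx; have cx' : chart_dom c ((x * g) * g^-1)%g by rewrite mulgK.
have [dL _] := right_mul_jacobian cx dgx; have [dL' _] := right_mul_jacobian dgx cx'.
have [_ <-] := chart_jacobian_comp MC cx dgx (@continuous_right_mul g x) dL dL'.
rewrite (_ : _ \o _ = id); first by have [] := chart_jacobian_id MC cx.
by apply/funext => h /=; rewrite mulgK.
Qed.

End LieGroup.

(** * The geodesic Hamiltonian *)

Lemma posdef_unitmx (R : realType) (n : nat) (A : 'M[R]_n) :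
  symmetric_posdef A -> A \in unitmx.
Proof.
case=> _ pA; rewrite unitmxE unitfE; apply/negP => /det0P[v v0 vA].
by have := pA v v0; rewrite vA /pairing mul0mx mxE ltxx.
Qed.

Lemma pairing_mul_tr (R : realType) (n : nat) (p v : 'rV[R]_n) (T : 'M[R]_n) :
  pairing (p *m T^T) v = pairing p (v *m T).
Proof. by rewrite /pairing trmx_mul mulmxA. Qed.

(** For the metric at x, [J] is the Jacobian of the translation from x to the unit and [K] that of
    the translation back, whose rows are the left-invariant frame. The inverse metric is thus
    expressed through that frame. *)
Lemma invmx_congruence (R : realType) (n : nat) (A J K : 'M[R]_n) :
  A \in unitmx -> K *m J = 1%:M ->
  invmx (J *m A *m J^T) = K^T *m invmx A *m K.
Proof.
move=> uA KJ; have JK := mulmx1C KJ.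
have U : (J *m A *m J^T) *m (K^T *m invmx A *m K) = 1%:M.
  rewrite -!mulmxA [J^T *m _]mulmxA -trmx_mul KJ trmx1 mul1mx.
  by rewrite [A *m _]mulmxA mulmxV // mul1mx.
have [uM _] := mulmx1_unit U.
by rewrite -[LHS]mulmx1 -U mulKmx.
Qed.

(** [w 0 a] is the pairing of [p] with row [a] of [K]. The indices of [B] are swapped because
    [pairing] transposes its second argument. *)
Lemma pairing_quadratic (R : realType) (n : nat) (p : 'rV[R]_n) (K B : 'M[R]_n) :
  let w := p *m K^T in
  pairing p (p *m K^T *m B *m K) = \sum_a \sum_b B b a * (w 0 a * w 0 b).
Proof.
move=> w; rewrite /pairing -/w.
have -> : p *m (w *m B *m K)^T = w *m B^T *m w^T.
  by rewrite /w !trmx_mul trmxK !mulmxA.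
clearbody w; rewrite mxE exchange_big.
apply: eq_bigr => b _; rewrite mxE mulr_suml; apply: eq_bigr => a _.
by rewrite !mxE; ring.
Qed.

(** * Invariant vector fields and their momenta *)

Section Geodesic.
Variables (R : realType) (n : nat) (G : groupTopologicalType) (C : atlas R n G).
Hypothesis GC : lie_group C.
Implicit Types (c d : chart C) (x : G) (q : 'rV[R]_n).

Let MC : smooth_manifold C := lie_group_manifold GC.
Let e := chart_at C 1%g.
Let u0 : 'rV[R]_n := chart_map e 1%g.
Let e1 : chart_dom e 1%g := chart_at_dom MC 1%g.

(** The derivative of x t at t = 1 in the basis direction [a], with x and x t both read in [c]. As a
    partial derivative of [chart_mul] it is visibly smooth in [q]; [left_invariant_fieldE]
    identifies it with the image of a basis vector under a left translation. *)
Definition left_invariant_field c (a : 'I_n) q : 'rV[R]_n :=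
  'D_(row_mx 0 (delta_mx 0 a)) (chart_mul c e c) (row_mx q u0).

Definition right_invariant_field c (i : 'I_n) q : 'rV[R]_n :=
  'D_(row_mx (delta_mx 0 i) 0) (chart_mul e c c) (row_mx u0 q).

(** Defined through the distinguished charts, in which [covector z] is given; its regularity only
    appears in a fixed chart, by [right_momentum_chart]. *)
Definition right_momentum (i : 'I_n) (z : cotangent R n G) : R :=
  pairing (covector z)
    (row i (tangent_map C C (fun h => h * foot z)%g 1%g)).

Lemma left_invariant_fieldE c a x : chart_dom c x ->
  left_invariant_field c a (chart_map c x) =
  row a (chart_jacobian e c (fun h => x * h)%g 1%g).
Proof.
move=> cx; have cx1 : chart_dom c (x * 1)%g by rewrite mulg1.
by have [_ /(_ c a cx) ->] := left_mul_jacobian GC e1 cx1.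
Qed.

Lemma right_invariant_fieldE c i x : chart_dom c x ->
  right_invariant_field c i (chart_map c x) =
  row i (chart_jacobian e c (fun h => h * x)%g 1%g).
Proof.
move=> cx; have cx1 : chart_dom c (1 * x)%g by rewrite mul1g.
by have [_ /(_ c i cx) ->] := right_mul_jacobian GC e1 cx1.
Qed.

Lemma left_field_dom c q : chart_cod c q -> chart_mul_dom c e c (row_mx q u0).
Proof.
case=> x cx <-; apply: (chart_mul_domP GC) => //; by rewrite mulg1.
Qed.

Lemma right_field_dom c q : chart_cod c q -> chart_mul_dom e c c (row_mx u0 q).
Proof.
case=> x cx <-; apply: (chart_mul_domP GC) => //; by rewrite mul1g.
Qed.

Lemma differentiable_left_field c a q :
  chart_cod c q -> differentiable (left_invariant_field c a) q.
Proof.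
move=> /left_field_dom U.
exact: (derive_row_mxl (differentiable_derive_chart_mul GC _ U)).1.
Qed.

Lemma differentiable_right_field c i q :
  chart_cod c q -> differentiable (right_invariant_field c i) q.
Proof.
move=> /right_field_dom U.
exact: (derive_row_mxr (differentiable_derive_chart_mul GC _ U)).1.
Qed.

Lemma Ck_on_right_field k c i : Ck_on k (chart_cod c) (right_invariant_field c i).
Proof.
(* The slice sending [q] to ([u0], [q]) is affine, with linear part [l]. *)
pose l : {linear 'rV[R]_n -> 'rV[R]_(n + n)} := mulmxr (row_mx 0 1%:M).
have lE q : row_mx u0 0 + l q = row_mx u0 q.
  by rewrite /l /= mul_mx_row mulmx0 mulmx1 add_row_mx addr0 add0r.
have oU := @open_chart_mul_dom _ _ _ _ GC e c c.
have h := Ck_on_affine (row_mx u0 0) l oU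
  (@Ck_on_derive_chart_mul _ _ _ _ GC k e c c (row_mx (delta_mx 0 i) 0)).
have cU : chart_cod c `<=` [set q | chart_mul_dom e c c (row_mx u0 0 + l q)].
  by move=> q cq /=; rewrite lE; exact: right_field_dom.
apply: Ck_on_ext (Ck_on_sub cU h) => [|q _ /=]; first exact: open_chart_cod.
by rewrite lE.
Qed.

(** This is the vanishing of the Lie bracket of the two fields in the chart [c]: left multiplication
    by s and right multiplication by t, both near the unit, are the commuting actions. *)
Lemma left_right_commute c a i q : chart_cod c q ->
  'D_(right_invariant_field c i q) (left_invariant_field c a) q =
  'D_(left_invariant_field c a q) (right_invariant_field c i) q.
Proof.
move=> cq; have lU := left_field_dom cq; have rU := right_field_dom cq.
have cx := chart_dom_inv MC cq.
have ee := chart_cod_map e1.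
apply: derive_commuting_actions.
- by rewrite /chart_mul row_mxKl row_mxKr (chart_mapK MC e1) mulg1 (chart_invK MC).
- by rewrite /chart_mul row_mxKl row_mxKr (chart_mapK MC e1) mul1g (chart_invK MC).
- by apply: filterS (near_chart_mul_dom GC lU) => y; exact: differentiable_chart_mul.
- by apply: filterS (near_chart_mul_dom GC rU) => y; exact: differentiable_chart_mul.
- exact: differentiable_derive_chart_mul.
- exact: differentiable_derive_chart_mul.
(* In charts, associativity can be read only while s x and x t stay in the domain of [c], which
   holds for s and t close to the unit. *)
have nl : \forall s \near u0, chart_dom c (chart_inv e s * chart_inv c q)%g.
  apply: (@chart_inv_near _ _ _ _ MC e u0 (fun h => chart_dom c (h * chart_inv c q)%g)) => //.
  apply: (continuous_right_mul GC); rewrite (chart_mapK MC e1) mul1g.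
  by apply: open_nbhs_nbhs; split=> //; exact: open_chart_dom.
have nr : \forall t \near u0, chart_dom c (chart_inv c q * chart_inv e t)%g.
  apply: (@chart_inv_near _ _ _ _ MC e u0 (fun h => chart_dom c (chart_inv c q * h)%g)) => //.
  apply: (continuous_left_mul GC); rewrite (chart_mapK MC e1) mulg1.
  by apply: open_nbhs_nbhs; split=> //; exact: open_chart_dom.
have nl' : \forall y \near (row_mx u0 u0 : 'rV[R]_(n + n)),
    chart_dom c (chart_inv e (lsubmx y) * chart_inv c q)%g.
  apply: (@continuous_lsubmx R 1 n n (row_mx u0 u0) (fun s =>
    chart_dom c (chart_inv e s * chart_inv c q)%g)).
  by rewrite row_mxKl.
have nr' : \forall y \near (row_mx u0 u0 : 'rV[R]_(n + n)),
    chart_dom c (chart_inv c q * chart_inv e (rsubmx y))%g.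
  apply: (@continuous_rsubmx R 1 n n (row_mx u0 u0) (fun t =>
    chart_dom c (chart_inv c q * chart_inv e t)%g)).
  by rewrite row_mxKr.
apply: filterS2 nl' nr' => y ly ry.
rewrite /chart_mul !row_mxKl !row_mxKr !(chart_mapK MC) // mulgA //.
Qed.

Lemma coord_change_jacobian c d x : coord_change c d x = chart_jacobian c d id x.
Proof. by []. Qed.

Lemma tangent_map_jacobian (f : G -> G) x :
  tangent_map C C f x = chart_jacobian (chart_at C x) (chart_at C (f x)) f x.
Proof. by []. Qed.

(** The canonical chart multiplies the covector by a transposed coordinate change. By duality this
    matrix passes to the vector, where the chain rule absorbs it: the frame vector in [chart_at x]
    becomes the one in [c], and [chart_at] disappears. *)
Lemma right_momentum_chart c i (y : 'rV[R]_(n + n)) :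
  chart_cod c (lsubmx y) ->
  right_momentum i (chart_inv (c : chart (cotangent_atlas C)) y) =
  momentum (right_invariant_field c i) y.
Proof.
move=> cy; set x := chart_inv c (lsubmx y).
have cx : chart_dom c x := chart_dom_inv MC cy.
have xx : chart_dom (chart_at C x) x := chart_at_dom MC x.
have xx1 : chart_dom (chart_at C x) (1 * x)%g by rewrite mul1g.
have [dR _] := right_mul_jacobian GC e1 xx1.
have dT : chart_differentiable (chart_at C x) c id (1 * x)%g.
  by apply: (chart_differentiable_id MC) => //; rewrite mul1g.
rewrite /right_momentum /momentum /= -/x pairing_mul_tr; congr pairing.
rewrite -(chart_invK MC cy) right_invariant_fieldE // -/x.
have [_ E] := chart_jacobian_comp MC e1 xx1 (@continuous_right_mul _ _ _ _ GC x 1%g) dR dT.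
rewrite mul1g in E; rewrite [chart_jacobian e c _ _]E row_mul coord_change_jacobian.
by rewrite tangent_map_jacobian mul1g.
Qed.

Lemma geodesic_hamiltonian_chart c (A : 'M[R]_n) (y : 'rV[R]_(n + n)) :
  A \in unitmx -> chart_cod c (lsubmx y) ->
  geodesic_hamiltonian C A (chart_inv (c : chart (cotangent_atlas C)) y) =
  \sum_a \sum_b (2^-1 *: (invmx A)^T) a b *
    (momentum (left_invariant_field c a) y * momentum (left_invariant_field c b) y).
Proof.
move=> uA cy; set x := chart_inv c (lsubmx y).
have cx : chart_dom c x := chart_dom_inv MC cy.
have xx : chart_dom (chart_at C x) x := chart_at_dom MC x.
have xx1 : chart_dom (chart_at C x) (x * 1)%g by rewrite mulg1.
have [dL _] := left_mul_jacobian GC e1 xx1.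
have dT : chart_differentiable (chart_at C x) c id (x * 1)%g.
  by apply: (chart_differentiable_id MC) => //; rewrite mulg1.
have [_ E] := chart_jacobian_comp MC e1 xx1 (@continuous_left_mul _ _ _ _ GC x 1%g) dL dT.
have KJ := left_mul_jacobianV GC e1 xx1.
rewrite mulg1 in E KJ.
set K := chart_jacobian e (chart_at C x) _ _ in E KJ.
set T := chart_jacobian _ c id x in E.
rewrite /geodesic_hamiltonian /= -/x /left_invariant_metric.
have -> : tangent_map C C (fun h => x^-1 * h)%g x =
    chart_jacobian (chart_at C x) e (fun h => x^-1 * h)%g x.
  by rewrite tangent_map_jacobian mulVg.
set J := chart_jacobian (chart_at C x) e _ x in KJ *.
rewrite (invmx_congruence uA KJ).
rewrite coord_change_jacobian -/T.
set p := rsubmx y.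
(* The left-invariant momenta. The coordinate change [T] and the frame [K] combine by [E] into the
   frame read in [c]. *)
pose w := p *m T^T *m K^T.
have wE a : momentum (left_invariant_field c a) y = w 0 a.
  rewrite /momentum -(chart_invK MC cy) left_invariant_fieldE // -/x.
  rewrite [chart_jacobian e c _ _]E row_mul -pairing_mul_tr.
  by rewrite /pairing tr_row colE mulmxA -colE mxE.
rewrite !mulmxA pairing_quadratic mulr_sumr; apply: eq_bigr => a _.
rewrite mulr_sumr; apply: eq_bigr => b _.
have -> : (2^-1 *: (invmx A)^T) a b = 2^-1 * invmx A b a by rewrite !mxE.
by rewrite -[RHS]mulrA; congr (_ * (_ * (_ * _))); exact/esym/wE.
Qed.

Lemma right_momentum_integral (A : 'M[R]_n) i : A \in unitmx ->
  integral_of_motion C (geodesic_hamiltonian C A) (right_momentum i).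
Proof.
move=> uA z; set c := chart_at C (foot z).
have cz : chart_dom c (foot z) := chart_at_dom MC _.
pose c' : chart (cotangent_atlas C) := c.
pose y := chart_map c' z.
have cy : chart_cod c (lsubmx y) by rewrite /y /= row_mxKl; exact: chart_cod_map.
have ny : \forall y' \near y, chart_cod c (lsubmx y').
  exact: (continuous_lsubmx (chart_cod_near MC cy)).
(* Brackets at z depend only on the functions near [y], so both may be replaced by their expressions
   in the chart at z. *)
have gE (f g : 'rV[R]_(n + n) -> R^o) : {near y, f =1 g} -> gradient f y = gradient g y.
  by move=> fg; apply/rowP => j; rewrite !mxE; exact: near_eq_derive.
pose H (y : 'rV[R]_(n + n)) : R^o := \sum_a \sum_b (2^-1 *: (invmx A)^T) a b *
    (momentum (left_invariant_field c a) y * momentum (left_invariant_field c b) y).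
have EH : gradient (geodesic_hamiltonian C A \o chart_inv c') y = gradient H y.
  by apply: gE; apply: filterS ny => y' cy'; exact: geodesic_hamiltonian_chart.
have EF : gradient (right_momentum i \o chart_inv c') y =
    gradient (momentum (right_invariant_field c i)) y.
  by apply: gE; apply: filterS ny => y' cy'; exact: right_momentum_chart.
suff : symplectic_form (symplectic_gradient H y)
    (symplectic_gradient (momentum (right_invariant_field c i)) y) = 0.
  by rewrite /symplectic_gradient -EH -EF.
apply: (symplectic_form_quadratic _ _ _).2 => a.
  by have [] := derive_momentum (differentiable_left_field a cy).
rewrite symplectic_form_momentum; last 2 first.
- exact: differentiable_left_field.
- exact: differentiable_right_field.
by rewrite left_right_commute // subrr /pairing trmx0 mulmx0 mxE.
Qed.

Lemma right_momentum_Ck k i : Ck_function (cotangent_atlas C) k (right_momentum i).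
Proof.
(* The codomain of the canonical chart lies in [V], which is open as the preimage of an open set
   under the projection to q. *)
move=> c; pose V := [set y : 'rV[R]_(n + n) | chart_cod (c : chart C) (lsubmx y)].
have oV : open V.
  by apply: open_comp => [y _|]; [exact: continuous_lsubmx|exact: open_chart_cod].
apply: (@Ck_on_sub _ _ _ _ _ V).
  by move=> _ [z cz <-]; rewrite /V /= row_mxKl; exact: chart_cod_map.
have h := Ck_on_momentum (@open_chart_cod _ _ _ _ MC (c : chart C)) (@Ck_on_right_field k c i).
apply: (Ck_on_ext oV _ h) => y; rewrite inE => Vy.
exact/esym/right_momentum_chart.
Qed.

(** The p-parts of the differentials are the rows of the Jacobian of a right translation, a matrix
    made invertible by the inverse translation; a linear relation is therefore tested on p-parts
    alone. *)
Lemma right_momentum_free z :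
  free [tuple differential (cotangent_atlas C) (right_momentum i) z | i < n].
Proof.
set c := chart_at C (foot z).
have cz : chart_dom c (foot z) := chart_at_dom MC _.
pose c' : chart (cotangent_atlas C) := c.
pose y := chart_map c' z.
have cy : chart_cod c (lsubmx y) by rewrite /y /= row_mxKl; exact: chart_cod_map.
have ny : \forall y' \near y, chart_cod c (lsubmx y').
  exact: (continuous_lsubmx (chart_cod_near MC cy)).
have cz1 : chart_dom c (1 * foot z)%g by rewrite mul1g.
have dE i : rsubmx (differential (cotangent_atlas C) (right_momentum i) z) =
    row i (chart_jacobian e c (fun h => h * foot z)%g 1%g).
  rewrite -right_invariant_fieldE //.
  have := rsubmx_gradient_momentum (differentiable_right_field i cy).
  rewrite {2}/y /= row_mxKl => <-; congr rsubmx; apply/rowP => j; rewrite !mxE.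
  apply: near_eq_derive; apply: filterS ny => y' cy'; exact: right_momentum_chart.
apply/freeP => k; rewrite (eq_bigr (fun i => k i *:
    differential (cotangent_atlas C) (right_momentum i) z)); last first.
  by move=> i _; rewrite -tnth_nth tnth_mktuple.
move=> /(congr1 rsubmx); rewrite linear_sum linear0 /=.
set J := chart_jacobian e c _ _ in dE.
have -> : \sum_i rsubmx (k i *: differential (cotangent_atlas C) (right_momentum i) z) =
    (\row_i k i) *m J.
  rewrite [RHS]mulmx_sum_row; apply: eq_bigr => i _.
  by rewrite linearZ /= dE mxE.
move=> /(congr1 (mulmx^~ (chart_jacobian c e (fun h => h * (foot z)^-1)%g (1 * foot z)%g))).
rewrite -mulmxA /J right_mul_jacobianV // mulmx1 mul0mx => k0 i.
by have := congr1 (fun v : 'rV[R]_n => v 0 i) k0; rewrite !mxE.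
Qed.

End Geodesic.

Theorem propositionA1 (R : realType) (n : nat) (G : groupTopologicalType)
    (C : atlas R n G) (A : 'M[R]_n) :
  lie_group C -> compact [set: G]%classic -> symmetric_posdef A ->
  weakly_integrable C (geodesic_hamiltonian C A).
Proof.
move=> GC _ /posdef_unitmx uA; exists (@right_momentum R n G C); split.
- by move=> i; exact: right_momentum_integral.
- by move=> i; exact: right_momentum_Ck.
- by move=> z; exact: right_momentum_free.
Qed.
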